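(* Let $\mathbf H$ be an arborescent pseudovariety of groups. Then every closed subgroup of a free pro-$\overline{\mathbf H}$ monoid is a projective profinite group, and each finite subsemigroup of a free pro-$\overline{\mathbf H}$ monoid is a band.
   Context: A pseudovariety of groups (resp. monoids) is a class of finite groups (resp. monoids) closed under finite direct products, subgroups (resp. submonoids) and homomorphic images. A pseudovariety of groups $\mathbf H$ is arborescent if whenever $1\to A\to G\to H\to 1$ is a short exact sequence of groups with $A,H\in\mathbf H$ and $A$ abelian, one has $G\in\mathbf H$. $\overline{\mathbf H}$ denotes the pseudovariety of all finite monoids all of whose subgroups (subsemigroups that are groups) belong to $\mathbf H$. For a pseudovariety of monoids $\mathbf V$, a pro-$\mathbf V$ monoid is a topological monoid that is a projective limit of (discrete) members of $\mathbf V$. For a topological space $X$, the free pro-$\mathbf V$ monoid on $X$ is the pro-$\mathbf V$ monoid $\widehat{F_{\mathbf V}}(X)$ equipped with a continuous map $X\to\widehat{F_{\mathbf V}}(X)$ such that every continuous map from $X$ to a pro-$\mathbf V$ monoid $M$ extends uniquely to a continuous monoid homomorphism $\widehat{F_{\mathbf V}}(X)\to M$. A closed subgroup of a profinite monoid is a topologically closed subsemigroup that is a group under the induced multiplication (its identity is an idempotent, not necessarily the identity of the monoid); it is given the induced topology. A profinite group $G$ is projective if for every finite group $A$, every epimorphism of finite groups $\alpha:A\to B$, and every continuous epimorphism $\varphi:G\to B$ ($B$ discrete), there is a continuous homomorphism $\widetilde\varphi:G\to A$ with $\alpha\circ\widetilde\varphi=\varphi$. A finite semigroup is a band if each of its elements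 is idempotent. *)

(* Defs.v *)
From HB Require Import structures.
From mathcomp Require Import all_boot all_fingroup.
From mathcomp Require Import all_classical topology.

Set Implicit Arguments.
Unset Strict Implicit.
Unset Printing Implicit Defensive.



Local Open Scope classical_set_scope.
Local Open Scope group_scope.

(* A type with a monoid (group) structure and a topology, with no compatibility
   assumed: continuity of the operations is part of [pro] and
   [profinite_group] below. *)
#[short(type="preTopologicalMonoidType")]
HB.structure Definition PreTopologicalMonoid := {M of Topological M & monoid.Monoid M}.

#[short(type="preTopologicalGroupType")]
HB.structure Definition PreTopologicalGroup := {G of Topological G & monoid.Group G}.

Definition subsemigroup (M : monoidType) (S : set M) : Prop :=
  forall x y, S x -> S y -> S (x * y).

Definition band (M : monoidType) (S : set M) : Prop :=
  forall x, S x -> x * x = x.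

(* The identity [e] is an idempotent of [M] that may differ from [1]. *)
Definition subgroup (M : monoidType) (S : set M) : Prop :=
  subsemigroup S /\
  exists2 e, S e &
    (forall x, S x -> e * x = x /\ x * e = x) /\
    (forall x, S x -> exists2 y, S y & x * y = e /\ y * x = e).

(* The subset [S] as a group in its own right. *)
Definition subgroup_type (M : monoidType) (S : set M) (gS : subgroup S) : Type :=
  set_type S.

Section SubgroupType.
Variables (M : monoidType) (S : set M) (gS : subgroup S).
Local Notation T := (subgroup_type gS).

HB.instance Definition _ := Choice.copy T (set_type S).

Let inS (x : T) : S (set_val x). Proof. exact: set_valP. Qed.

Definition subgroup_mul (x y : T) : T :=
  exist _ (set_val x * set_val y) (mem_set (gS.1 _ _ (inS x) (inS y))).

Let one_sig := cid2 gS.2.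

Definition subgroup_one : T := exist _ (s2val one_sig) (mem_set (s2valP one_sig)).

Let inv_sig (x : T) := cid2 ((s2valP' one_sig).2 _ (inS x)).

Definition subgroup_inv (x : T) : T :=
  exist _ (s2val (inv_sig x)) (mem_set (s2valP (inv_sig x))).

Let mulA : associative subgroup_mul.
Proof. by move=> x y z; apply: val_inj; rewrite /= mulgA. Qed.

Let mul1 : left_id subgroup_one subgroup_mul.
Proof. by move=> x; apply: val_inj; exact: ((s2valP' one_sig).1 _ (inS x)).1. Qed.

Let mulr1 : right_id subgroup_one subgroup_mul.
Proof. by move=> x; apply: val_inj; exact: ((s2valP' one_sig).1 _ (inS x)).2. Qed.

Let mulV : left_inverse subgroup_one subgroup_inv subgroup_mul.
Proof. by move=> x; apply: val_inj; exact: (s2valP' (inv_sig x)).2. Qed.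

Let mulrV : right_inverse subgroup_one subgroup_inv subgroup_mul.
Proof. by move=> x; apply: val_inj; exact: (s2valP' (inv_sig x)).1. Qed.

HB.instance Definition _ := isGroup.Build T mulA mul1 mulr1 mulV mulrV.
End SubgroupType.

(* [set_type] carries the topology induced from the ambient space. *)
HB.instance Definition _ (M : preTopologicalMonoidType) (S : set M)
    (gS : subgroup S) :=
  Topological.copy (subgroup_type gS) (set_type S).

(* Finite direct products include the empty one, so the trivial group belongs
   to every pseudovariety.  Closure under images includes closure under
   isomorphism. *)
Record pseudovariety_of_groups (H : finGroupType -> Prop) : Prop := {
  pseudovariety_prod : forall (I : finType) (G : I -> finGroupType),
    (forall i, H (G i)) -> H {dffun forall i, G i};
  pseudovariety_sub : forall (G : finGroupType) (K : {group G}),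
    H G -> H (subg_of K);
  pseudovariety_image : forall (G Q : finGroupType) (f : G -> Q),
    {morph f : x y / x * y} -> range f = [set: Q] -> H G -> H Q
}.

(* [G] may be taken finite: an extension of a finite group by a finite group is
   finite. *)
Definition arborescent (H : finGroupType -> Prop) : Prop :=
  forall (A G Q : finGroupType) (i : A -> G) (p : G -> Q),
    {morph i : x y / x * y} -> {morph p : x y / x * y} ->
    injective i -> range i = p @^-1` [set 1] -> range p = [set: Q] ->
    abelian [set: A]%G -> H A -> H Q -> H G.

Definition overline (H : finGroupType -> Prop) (M : monoidType) : Prop :=
  finite_set [set: M] /\
  forall (S : set M) (gS : subgroup S),
    exists2 G : finGroupType, H G &
      exists f : G -> subgroup_type gS, bijective f /\ {morph f : x y / x * y}.

Record proj_system (V : monoidType -> Prop) := {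
  ps_index : Type;
  ps_le : ps_index -> ps_index -> Prop;
  ps_inhabited : inhabited ps_index;
  ps_refl : forall i, ps_le i i;
  ps_trans : forall j i k, ps_le i j -> ps_le j k -> ps_le i k;
  ps_directed : forall i j, exists2 k, ps_le i k & ps_le j k;
  ps_obj : ps_index -> monoidType;
  ps_objP : forall i, V (ps_obj i);
  ps_map : forall i j, ps_le i j -> ps_obj j -> ps_obj i;
  ps_mapM : forall i j (ij : ps_le i j), monoid_morphism (ps_map ij);
  ps_map_id : forall i (ii : ps_le i i) x, ps_map ii x = x;
  ps_map_comp : forall i j k (ij : ps_le i j) (jk : ps_le j k) (ik : ps_le i k) x,
    ps_map ij (ps_map jk x) = ps_map ik x
}.

Definition ps_prod (V : monoidType -> Prop) (D : proj_system V) : topologicalType :=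
  prod_topology (fun i : ps_index D => discrete_topology (ps_obj i)).

(* The projective limit, as a subset of the product. *)
Definition ps_lim (V : monoidType -> Prop) (D : proj_system V) : set (ps_prod D) :=
  [set x | forall i j (ij : ps_le i j), ps_map ij (x j) = x i].
Arguments ps_lim {V} D _.

(* [M] is a topological monoid and [f] is an isomorphism of topological monoids
   from [M] onto the projective limit of [D], the latter with the topology
   induced from the product of the discrete monoids of [D]. *)
Definition pro (V : monoidType -> Prop) (M : preTopologicalMonoidType) : Prop :=
  continuous (fun xy : M * M => xy.1 * xy.2) /\
  exists (D : proj_system V) (f : M -> ps_prod D),
    [/\ forall i, monoid_morphism (fun x => f x i : ps_obj i),
        injective f,
        range f = ps_lim D &
        forall U : set M, open U <-> exists2 W : set (ps_prod D), open W & f @^-1` W = U].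

Definition free_pro (V : monoidType -> Prop) (X : topologicalType)
    (F : preTopologicalMonoidType) (iota : X -> F) : Prop :=
  [/\ pro V F,
      continuous iota &
      forall (M : preTopologicalMonoidType) (g : X -> M), pro V M -> continuous g ->
        exists! h : F -> M,
          [/\ monoid_morphism h, continuous h & forall x, h (iota x) = g x]].

Definition finite_group (M : monoidType) : Prop :=
  finite_set [set: M] /\ forall x : M, exists y, x * y = 1 /\ y * x = 1.

Definition profinite_group (G : preTopologicalGroupType) : Prop :=
  pro finite_group G /\ continuous (fun x : G => x^-1).

Definition projective_group (G : preTopologicalGroupType) : Prop :=
  forall (A B : finGroupType) (alpha : A -> B) (phi : G -> B),
    {morph alpha : x y / x * y} -> range alpha = [set: B] ->
    {morph phi : x y / x * y} -> range phi = [set: B] ->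
    continuous (phi : G -> discrete_topology B) ->
    exists psi : G -> A,
      [/\ {morph psi : x y / x * y},
          continuous (psi : G -> discrete_topology A) &
          alpha \o psi = phi].

(* Main.v *)
From HB Require Import structures.
Require Import Defs.
From mathcomp Require Import all_boot all_fingroup all_solvable zmodp.
From mathcomp Require Import all_classical topology.

Set Implicit Arguments.
Unset Strict Implicit.
Unset Printing Implicit Defensive.

Local Open Scope classical_set_scope.
Local Open Scope group_scope.

(** Write [V] for the pseudovariety [overline H] and [F] for the free pro-[V]
    monoid.  Freeness enters only through a lifting property
    ([free_pro_lifts]): if [q : N -> M] is onto, with [M] and [N] finite members
    of [V], then every continuous morphism [F -> M] factors through [q]; it is
    enough to choose preimages of the images of the generators.  So whatever
    happens in a finite quotient [M] of [F] can be refined by replacing [M] with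
    a cover [N] of our choice, provided that [N] is still in [V].

    The covers are monoids of pairs [(m, tau)], with [m] in [M] and [tau] a
    transformation of an auxiliary finite set compatible with [m]
    ([expansion]).  Because [H] is arborescent, such a cover is in [V] as soon
    as every subgroup of it that collapses to a point of [M] embeds in an
    abelian member of [H] ([overline_extension]).

    Projectivity.  Let [S] be a closed subgroup of [F], let [phi : S -> B] be
    continuous and onto, and let [alpha : A -> B] be an epimorphism of finite
    groups with abelian kernel in [H].  The map [phi] factors as [rho : T -> B]
    through the image [T] of [S] in some finite quotient [M] ([subgroup_factor]).
    Let [e] be the identity of [T].  The elements that are R-equivalent to [e]
    form a free left [T]-set on which [M] acts partially on the right, so [M]
    acts by monomial matrices with entries in [T]; pushing the entries to [B]
    by [rho] and lifting them through [alpha] gives a cover of [M] whose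
    subgroups above [T] map to [A] by their entry at [e]
    ([monomial_expansion]).  Lifting [F -> M] to this cover solves the embedding
    problem.  Arbitrary kernels reduce to abelian ones by a Frattini argument
    ([projective_of_abelian]).

    Bands.  Let [x] lie in a finite subsemigroup of [F], so that some power
    [e = x^n] with [n > 0] is idempotent.  If, in a finite quotient, [x] were
    not in the ideal generated by [e], a cover that counts disjoint factors
    lying in this ideal, up to [n + 1], would separate [x^n] from [x^(2n)]: at
    most [n] such factors fit in [x^n], since none is contained in a single [x]
    ([counting_expansion]).  Hence [x] is in this ideal in all finite quotients,
    and then finiteness gives [e x = x] ([power_factor_stable]).  Therefore the
    powers of [x] form a finite cyclic group, which is projective by the first
    part.  A finite projective cyclic group of order [m] is trivial, because the
    projection from [Z/m^2] to [Z/m] splits only for [m = 1]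
    ([projective_cyclic_trivial]), so [x = e]. *)

(** * Finite sets and finite groups *)

Lemma finite_enum (T : choiceType) : finite_set [set: T] ->
  exists n (g : 'I_n -> T), forall x, exists i, g i = x.
Proof.
move=> /finite_seqP[s sT].
have sP x : x \in s by have : [set: T] x by []; rewrite sT.
exists (size s), (tnth (in_tuple s)) => x.
by have /tnthP[i ->] : x \in in_tuple s by []; exists i.
Qed.

Lemma finite_inj (T U : Type) (f : T -> U) :
  injective f -> finite_set [set: U] -> finite_set [set: T].
Proof.
move=> fI finU; rewrite -(preimage_setT f).
by apply: finite_preimage finU => x y _ _; exact: fI.
Qed.

Lemma finite_arrow (T U : choiceType) :
  finite_set [set: T] -> finite_set [set: U] -> finite_set [set: T -> U].
Proof.
move=> /finite_enum[n [g gS]] /finite_enum[m [h hS]].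
have /choice[k kK] : forall u, exists i, h i = u by [].
pose r (f : T -> U) : {ffun 'I_n -> 'I_m} := [ffun i => k (f (g i))].
apply: (@finite_inj _ _ r); last exact: finite_finset.
move=> f f' /ffunP rff'; apply/funext => x.
by have [i <-] := gS x; have := rff' i; rewrite !ffunE => /(can_inj kK).
Qed.

Lemma finGroup_of (G : groupType) : finite_set [set: G] ->
  exists (K : finGroupType) (f : K -> G),
    bijective f /\ {morph f : x y / x * y}.
Proof.
move=> /finite_seqP[s sT].
have sP x : x \in s by have : [set: G] x by []; rewrite sT.
have pickleK : pcancel (fun x => index x s) (fun n => Some (nth 1 s n)).
  by move=> x; rewrite nth_index.
have enumP : Finite.axiom (undup s : seq G).
  by move=> x; rewrite count_uniq_mem ?undup_uniq// mem_undup sP.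
pose C := isCountable.Build G pickleK.
pose CT : countType := HB.pack G C.
pose E := @isFinite.Build CT (undup s) enumP.
pose K : finGroupType := HB.pack G C E.
by exists K, id; split=> //; exists id.
Qed.

Lemma morph_group1 (G K : groupType) (f : G -> K) :
  {morph f : x y / x * y} -> f 1 = 1.
Proof. by move=> fM; apply: (mulgI (f 1)); rewrite -fM !mulg1. Qed.

Lemma morph_groupV (G K : groupType) (f : G -> K) :
  {morph f : x y / x * y} -> {morph f : x / x^-1}.
Proof.
by move=> fM x; apply: (mulgI (f x)); rewrite -fM !mulgV (morph_group1 fM).
Qed.

Lemma morph_groupX (G K : groupType) (f : G -> K) n :
  {morph f : x y / x * y} -> {morph f : x / x ^+ n}.
Proof.
move=> fM x; elim: n => [|n IHn]; first exact: morph_group1.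
by rewrite !expgS fM IHn.
Qed.

Lemma pseudovariety_inj (H : finGroupType -> Prop) (A B : finGroupType)
    (j : A -> B) :
  pseudovariety_of_groups H -> {morph j : x y / x * y} -> injective j ->
  H B -> H A.
Proof.
move=> pvH jM jI HB.
pose jm : {morphism [set: A]%SET >-> B} := @Morphism _ _ [set: A]%SET _ (in2W jM).
pose K := (jm @* [set: A])%G.
have jK (u : subg_of K) : exists a, j a = sgval u.
  by have /morphimP[a _ _ ->] := subgP u; exists a.
have [r rK] := choice jK.
apply: (pseudovariety_image pvH (f := r)) (pseudovariety_sub pvH K HB).
  by move=> u v; apply: jI; rewrite jM !rK.
apply/seteqP; split=> // a _.
have Ka : j a \in K by apply: mem_morphim; rewrite ?inE.
by exists (Subg Ka) => //; apply: jI; rewrite rK.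
Qed.

Lemma abelian_inj (A B : finGroupType) (j : A -> B) :
  {morph j : x y / x * y} -> injective j -> abelian [set: B]%SET ->
  abelian [set: A]%SET.
Proof.
move=> jM jI /centsP cB; apply/centsP => x _ y _; apply: jI.
by rewrite !jM; apply: cB; rewrite inE.
Qed.

(** * Neighbourhoods in projective limits *)

Section ProductNeighbourhoods.
Variables (V : monoidType -> Prop) (D : proj_system V).

(** The index set is directed, so a basic neighbourhood in the limit, which
    constrains finitely many coordinates, can be shrunk to one that constrains a
    single coordinate. *)
Lemma ps_lim_nbhs (W : set (ps_prod D)) (x : ps_prod D) :
  open W -> ps_lim D x -> W x ->
  exists i, forall y, ps_lim D y -> y i = x i -> W y.
Proof.
move=> oW limx Wx.
pose agree : set_system (ps_prod D) :=
  fun A => exists i, forall y, ps_lim D y -> y i = x i -> A y.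
have agree_filter : Filter agree.
  split.
  - by have [i] := ps_inhabited D; exists i.
  - move=> A B [i Ai] [j Bj].
    have [k ik jk] := ps_directed i j.
    exists k => y limy ykE; split.
    + by apply: Ai => //; rewrite -(limy _ _ ik) ykE limx.
    + by apply: Bj => //; rewrite -(limy _ _ jk) ykE limx.
  - by move=> A B AB [i Ai]; exists i => y limy /(Ai y limy) /AB.
(* Directedness makes [agree] a filter; it converges to [x] because it does so
   in each coordinate. *)
suff : agree --> x by move=> /(_ W); apply; exact: open_nbhs_nbhs.
apply/(@cvg_sup _ _ _ agree x agree_filter) => i A [_ [[B _ <-] Bx] BA].
by exists i => y _ yi; apply: BA; rewrite /= yi.
Qed.

Lemma ps_cylinder_open i (B : set (ps_obj i)) :
  open [set x : ps_prod D | B (x i)].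
Proof.
rewrite openE => x Bx.
suff : (nbhs x) [set y : ps_prod D | B (y i)] by [].
have /cvg_sup/(_ i) : nbhs x --> x by [].
apply; exists [set y : ps_prod D | B (y i)]; split=> //.
by exists B => //; exact: discrete_open.
Qed.

Lemma ps_fibre_topology (M : Type) (F : M -> ps_prod D) (U : set M) :
  (forall x, ps_lim D (F x)) ->
  (exists2 W : set (ps_prod D), open W & F @^-1` W = U) <->
  (forall x, U x -> exists i, forall y, F y i = F x i -> U y).
Proof.
move=> limF; split=> [[W oW <-] x Wx|Uloc].
  have [i iW] := ps_lim_nbhs oW (limF x) Wx.
  by exists i => y yx; apply: iW.
pose N x i := forall y, F y i = F x i -> U y.
exists (\bigcup_(xi in [set xi | N xi.1 xi.2])
  [set w : ps_prod D | [set F xi.1 xi.2] (w xi.2)]).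
  by apply: bigcup_open => xi _; exact: (@ps_cylinder_open _ [set F xi.1 xi.2]).
apply/seteqP; split=> [x [[z i] /= Nzi]|x Ux]; first exact: Nzi.
by have [i iU] := Uloc x Ux; exists (x, i).
Qed.

End ProductNeighbourhoods.

(** A presentation of [M] as a projective limit in terms of the maps to the
    finite levels, with the product topology eliminated: the fibres of the [f i]
    are a basis of open sets. *)
Record pro_cone (V : monoidType -> Prop) (M : preTopologicalMonoidType)
    (D : proj_system V) (f : forall i : ps_index D, M -> ps_obj i) : Prop := {
  cone_morphism : forall i, monoid_morphism (f i);
  cone_separated : forall x y, (forall i, f i x = f i y) -> x = y;
  cone_compatible : forall i j (ij : ps_le i j) x, ps_map ij (f j x) = f i x;
  cone_complete : forall t : forall i, ps_obj i,
    (forall i j (ij : ps_le i j), ps_map ij (t j) = t i) ->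
    exists x, forall i, f i x = t i;
  cone_open : forall U : set M, open U <->
    forall x, U x -> exists i, forall y, f i y = f i x -> U y
}.

Lemma proP (V : monoidType -> Prop) (M : preTopologicalMonoidType) :
  pro V M <-> exists (D : proj_system V) f, @pro_cone V M D f.
Proof.
split=> [[_ [D [f [fM fI fR fO]]]]|[D [f [fM fI fC fS fO]]]].
  have limf x : ps_lim D (f x) by rewrite -fR; exists x.
  exists D, (fun i x => f x i); split=> //.
  - by move=> x y fxy; apply: fI; exact: functional_extensionality_dep.
  - by move=> i j ij x; exact: limf.
  - move=> t tC; have : ps_lim D t by [].
    by rewrite -fR => -[x _ <-]; exists x.
  - by move=> U; rewrite fO; exact: ps_fibre_topology.
pose F x : ps_prod D := fun i => f i x.
have limF x : ps_lim D (F x) by move=> i j ij; exact: fC.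
split.
  apply/continuousP => U /fO Uloc.
  rewrite openE => -[x y] Uxy /=.
  have [i iU] := Uloc _ Uxy.
  exists ([set x' | f i x' = f i x], [set y' | f i y' = f i y]).
    by split; apply: open_nbhs_nbhs; split=> //; apply/fO => z /= zx;
      exists i => w wz /=; rewrite wz.
  by move=> [x' y'] /= [xx' yy']; apply: iU; rewrite !(fM i).2 xx' yy'.
exists D, F; split=> [i||| U].
- exact: fM.
- by move=> x y Fxy; apply: fI => i; have := congr1 (fun w : ps_prod D => w i) Fxy.
- apply/seteqP; split=> [_ [x _ <-]//|t /fS[x xt]].
  by exists x => //; exact: functional_extensionality_dep.
- by rewrite fO; apply: iff_sym; exact: (@ps_fibre_topology _ D _ F).
Qed.

(** A finite level, as the target of a continuous morphism. *)
HB.instance Definition _ (M : monoidType) :=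
  monoid.Monoid.copy (discrete_topology M) M.

Lemma discrete_continuousP (T : topologicalType) (U : choiceType)
    (f : T -> discrete_topology U) :
  continuous f <-> forall B : set U, open (f @^-1` B).
Proof.
split=> [/continuousP fC B|fO]; first exact/fC/discrete_open.
by apply/continuousP => B _; exact: fO.
Qed.

Lemma cone_continuous (V : monoidType -> Prop) (M : preTopologicalMonoidType)
    (D : proj_system V) (f : forall i : ps_index D, M -> ps_obj i) i :
  pro_cone f -> continuous (f i : M -> discrete_topology (ps_obj i)).
Proof.
move=> fcone; apply/discrete_continuousP => B; apply/(cone_open fcone) => x Bx.
by exists i => y fyx; rewrite /preimage /= fyx.
Qed.

Lemma finite_closed (V : monoidType -> Prop) (F : preTopologicalMonoidType)
    (S : set F) :
  pro V F -> finite_set S -> closed S.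
Proof.
move=> /proP[D [f fcone]] finS.
suff /accessible_finite_set_closed : accessible_space F by apply.
move=> x y /eqP xy.
have [i fxy] : exists i, f i x <> f i y.
  apply: contrapT => nE; apply: xy; apply: (cone_separated fcone) => i.
  by apply: contrapT => fxy; apply: nE; exists i.
exists [set z | f i z = f i x]; split.
- by apply/(cone_open fcone) => z zx; exists i => w wz; rewrite /= wz.
- by rewrite inE.
- by rewrite inE /= => /esym.
Qed.

(** * Lifting along surjections of finite monoids *)

Lemma pro_discrete (V : monoidType -> Prop) (M : monoidType) :
  V M -> pro V (discrete_topology M).
Proof.
move=> VM; apply/proP.
pose D : proj_system V := {|
  ps_index := unit; ps_le := fun _ _ => True; ps_inhabited := inhabits tt;
  ps_refl := fun=> I; ps_trans := fun _ _ _ _ _ => I;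
  ps_directed := fun _ _ => ex_intro2 _ _ tt I I;
  ps_obj := fun=> M; ps_objP := fun=> VM;
  ps_map := fun _ _ _ x => x;
  ps_mapM := fun _ _ _ => conj erefl (fun _ _ => erefl);
  ps_map_id := fun _ _ _ => erefl;
  ps_map_comp := fun _ _ _ _ _ _ _ => erefl |}.
exists D, (fun _ x => x); split=> //.
- by move=> x y /(_ tt).
- by move=> t tC; exists (t tt) => -[].
- move=> U; split=> [_ x Ux|_]; last exact: discrete_open.
  by exists tt => y ->.
Qed.

Definition lifts (V : monoidType -> Prop) (F : preTopologicalMonoidType) :=
  forall (M N : monoidType) (q : N -> M) (f : F -> discrete_topology M),
    V M -> V N -> monoid_morphism q -> (forall m, exists n, q n = m) ->
    monoid_morphism f -> continuous f ->
    exists g : F -> discrete_topology N,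
      [/\ monoid_morphism g, continuous g & forall x, q (g x) = f x].

(** The lift is determined by choosing preimages of the images of the
    generators, continuously since [M] is discrete; that it lies over [f] is the
    uniqueness part of the universal property of [F]. *)
Lemma free_pro_lifts (V : monoidType -> Prop) (X : topologicalType)
    (F : preTopologicalMonoidType) (iota : X -> F) :
  free_pro V iota -> lifts V F.
Proof.
move=> [_ iotaC univ] M N q f VM VN qM /choice[s sK] fM fC.
have fiC : continuous (f \o iota : X -> discrete_topology M).
  by move=> x; apply: continuous_comp; [exact: iotaC|exact: fC].
have [|g [[gM gC gX] _]] := univ (discrete_topology N)
    (fun x => s (f (iota x))) (pro_discrete VN).
  by apply/discrete_continuousP => B; have /discrete_continuousP := fiC;
    move=> /(_ (s @^-1` B)).
exists g; split=> //.
have [h [_ hU]] := univ _ _ (pro_discrete VM) fiC.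
have <- : h = f by exact: hU.
have -> : h = q \o g; last by [].
apply: hU; split=> [||x /=]; last by rewrite gX sK.
  by split=> [|x y] /=; rewrite ?gM.1 ?gM.2 ?qM.1 ?qM.2.
apply/discrete_continuousP => B.
by move/discrete_continuousP: gC => /(_ (q @^-1` B)).
Qed.

(** * Subgroups of monoids *)

(** [set_val], with a type that exposes the group it comes from. *)
Definition sgincl (M : monoidType) (S : set M) (gS : subgroup S) :
  subgroup_type gS -> M := set_val.

Lemma sginclM (M : monoidType) (S : set M) (gS : subgroup S) :
  {morph @sgincl M S gS : x y / x * y}.
Proof. by []. Qed.

Lemma sgincl_inj (M : monoidType) (S : set M) (gS : subgroup S) :
  injective (@sgincl M S gS).
Proof. exact: val_inj. Qed.

Lemma sginclP (M : monoidType) (S : set M) (gS : subgroup S)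
  (x : subgroup_type gS) : S (sgincl x).
Proof. exact: set_valP. Qed.

Lemma sgincl_onto (M : monoidType) (S : set M) (gS : subgroup S) x :
  S x -> exists u : subgroup_type gS, sgincl u = x.
Proof. by move=> Sx; exists (exist _ x (mem_set Sx)). Qed.

Lemma subgroup_image (M N : monoidType) (q : M -> N) (S : set M) :
  {morph q : x y / x * y} -> subgroup S -> subgroup (q @` S).
Proof.
move=> qM [SM [e Se [e1 eV]]]; split.
  by move=> _ _ [x Sx <-] [y Sy <-]; exists (x * y); [exact: SM|exact: qM].
exists (q e); first by exists e.
split=> _ [x Sx <-].
  by rewrite -!qM (e1 x Sx).1 (e1 x Sx).2.
have [y Sy [xy yx]] := eV x Sx.
by exists (q y); [exists y|rewrite -!qM xy yx].
Qed.

Definition sgrestrict (M N : monoidType) (S : set M) (T : set N)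
    (gS : subgroup S) (gT : subgroup T) (k : M -> N)
    (kST : forall x, S x -> T (k x)) (u : subgroup_type gS) :
  subgroup_type gT := exist _ (k (sgincl u)) (mem_set (kST _ (sginclP u))).

Lemma subgroup_openP (F : preTopologicalMonoidType) (S : set F)
    (gS : subgroup S) (U : set (subgroup_type gS)) :
  open U <-> exists2 W : set F, open W & @sgincl F S gS @^-1` W = U.
Proof. by []. Qed.

(** * Extensions by abelian groups stay in the pseudovariety *)

(** A subgroup [S] of [N] is an extension of its image in [M], which is in [H],
    by the subgroup of the elements of [S] over the identity, to which the last
    hypothesis applies; [H] is closed under extensions with such a kernel. *)
Lemma overline_extension (H : finGroupType -> Prop) (M N : monoidType)
    (q : N -> M) :
  pseudovariety_of_groups H -> arborescent H ->
  overline H M -> finite_set [set: N] -> {morph q : x y / x * y} ->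
  (forall (S : set N) (e : M), subgroup S -> (forall x, S x -> q x = e) ->
     exists (A : finGroupType) (j : N -> A),
       [/\ H A, abelian [set: A]%SET, {in S &, {morph j : x y / x * y}} &
         {in S &, injective j}]) ->
  overline H N.
Proof.
move=> pvH arbH [_ HM] finN qM abN; split=> // S gS.
have [|G [f [fbij fM]]] := @finGroup_of (subgroup_type gS).
  exact: finite_inj (@sgincl_inj _ _ gS) finN.
exists G; last by exists f.
have gqS := subgroup_image qM gS.
have [Q HQ [h [[h' hK h'K] hM]]] := HM _ gqS.
have /choice[p pE] : forall g, exists u, sgincl (h u) = q (sgincl (f g)).
  move=> g; have [|v <-] := @sgincl_onto _ _ gqS (q (sgincl (f g))).
    by exists (sgincl (f g)) => //; exact: sginclP.
  by exists (h' v); rewrite h'K.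
have hI : injective (fun u => sgincl (h u)).
  by apply: inj_comp (can_inj hK); exact: sgincl_inj.
have pM : {morph p : x y / x * y}.
  by move=> x y; apply: hI; rewrite pE fM hM !sginclM !pE qM.
pose pm : {morphism [set: G]%SET >-> Q} := @Morphism _ _ [set: G]%SET _ (in2W pM).
(* [G] is an extension of [Q] by [K], and [fK] realizes [K] in [N]. *)
pose K := ('ker pm)%G.
have KP g : (g \in K) = (p g == 1) by rewrite !inE.
pose fK (u : subg_of K) := sgincl (f (sgval u)).
have fKM : {morph fK : x y / x * y} by move=> x y; rewrite /fK /= fM.
have [] := abN (range fK) (q (sgincl (f 1))).
- apply: subgroup_image => //; split=> //; exists 1 => //.
  split=> x _; first by rewrite mul1g mulg1.
  by exists x^-1; rewrite ?mulgV ?mulVg.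
- move=> _ [u _ <-]; rewrite /fK -!pE; congr (sgincl (h _)).
  by have := subgP u; rewrite KP => /eqP ->; rewrite (morph_group1 pM).
move=> A [j [HA abA jM jI]].
have jKM : {morph j \o fK : x y / x * y}.
  move=> x y /=; rewrite fKM jM//; apply/mem_set; first by exists x.
  by exists y.
have jKI : injective (j \o fK).
  move=> x y /= /jI jxy.
  apply/subg_inj/(bij_inj fbij)/sgincl_inj/jxy; apply/mem_set.
    by exists x.
  by exists y.
apply: (arbH (subg_of K) G Q sgval p) => //.
- exact: subg_inj.
- apply/seteqP; split=> [_ [u _ <-]|g /= pg].
    by have := subgP u; rewrite KP => /eqP.
  have Kg : g \in K by rewrite KP; apply/eqP.
  by exists (Subg Kg).
- apply/seteqP; split=> // u _.
  have [x Sx xu] := sginclP (h u).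
  have [v vx] := @sgincl_onto _ _ gS x Sx.
  have [f' _ f'K] := fbij.
  by exists (f' v) => //; apply: hI; rewrite pE f'K vx.
- exact: abelian_inj jKM jKI abA.
- exact: pseudovariety_inj pvH jKM jKI HA.
Qed.

(** * Monoids of compatible transformations *)

(** A submonoid of the product of [M] with the transformations of [Q], given by
    its membership predicate.  Transformations act on the right: the product of
    [s] and [t] applies [s] first. *)
Record action_spec (M : monoidType) (Q : choiceType) := ActionSpec {
  spec :> M -> (Q -> Q) -> Prop;
  spec1 : spec 1 id;
  specM : forall m n s t, spec m s -> spec n t -> spec (m * n) (t \o s)
}.

Definition expansion (M : monoidType) (Q : choiceType) (P : action_spec M Q) :
  Type := set_type [set x : M * (Q -> Q) | P x.1 x.2].

Section Expansion.
Variables (M : monoidType) (Q : choiceType) (P : action_spec M Q).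
Local Notation E := (expansion P).

HB.instance Definition _ :=
  Choice.copy E (set_type [set x : M * (Q -> Q) | P x.1 x.2]).

Let inP (x : E) : P (set_val x).1 (set_val x).2. Proof. exact: (set_valP x). Qed.

Definition expansion_mul (x y : E) : E :=
  exist _ ((set_val x).1 * (set_val y).1, (set_val y).2 \o (set_val x).2)
    (mem_set (specM (inP x) (inP y))).

Definition expansion_one : E := exist _ (1, id) (mem_set (spec1 P)).

Let mulA : associative expansion_mul.
Proof. by move=> x y z; apply: val_inj; rewrite /= mulgA. Qed.

Let mul1 : left_id expansion_one expansion_mul.
Proof.
move=> x; apply: val_inj; rewrite /= mul1g.
exact: esym (surjective_pairing _).
Qed.

Let mulr1 : right_id expansion_one expansion_mul.
Proof.
move=> x; apply: val_inj; rewrite /= mulg1.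
exact: esym (surjective_pairing _).
Qed.

HB.instance Definition _ := monoid.isMonoid.Build E mulA mul1 mulr1.

Definition base (x : E) : M := (set_val x).1.
Definition act (x : E) : Q -> Q := (set_val x).2.

Lemma expansionP x : P (base x) (act x). Proof. exact: inP. Qed.

Lemma base_morphism : monoid_morphism base. Proof. by []. Qed.

Lemma actM x y q : act (x * y) q = act y (act x q). Proof. by []. Qed.

Lemma expansion_ext x y : base x = base y -> act x = act y -> x = y.
Proof.
move=> bxy axy; apply: val_inj; rewrite /=.
rewrite [LHS]surjective_pairing [RHS]surjective_pairing.
by rewrite -/(base x) bxy -/(act x) axy.
Qed.

Lemma expansion_lift m t : P m t -> exists2 x, base x = m & act x = t.
Proof.
move=> Pmt.
by exists (exist _ (m, t) (mem_set (Pmt : [set x | P x.1 x.2] (m, t)))).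
Qed.

Lemma expansion_finite : finite_set [set: M] -> finite_set [set: Q] ->
  finite_set [set: E].
Proof.
move=> finM finQ; apply: (@finite_inj _ (M * (Q -> Q))%type set_val).
  exact: val_inj.
by rewrite -setXTT; apply: finite_setX => //; exact: finite_arrow.
Qed.
End Expansion.

(** * The monomial cover *)

(** [R] is the R-class of the idempotent [e].  The group [T] acts on it freely
    by left multiplication, so a [T]-equivariant map to [B] can be prescribed on
    one point of each orbit. *)
Lemma equivariant_map (M : monoidType) (T : set M) (e : M) (B : finGroupType)
    (rho : M -> B) :
  let R := [set s | e * s = s /\ exists y, s * y = e] in
  subsemigroup T -> T e -> (forall t, T t -> e * t = t /\ t * e = t) ->
  (forall t, T t -> exists2 u, T u & t * u = e /\ u * t = e) ->
  {in T &, {morph rho : x y / x * y}} ->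
  exists lam : M -> B, lam e = 1 /\
    forall t s, T t -> R s -> lam (t * s) = rho t * lam s.
Proof.
move=> R TM Te T1 TV rhoM.
have rhoM' t u : T t -> T u -> rho (t * u) = rho t * rho u.
  by move=> /mem_set Tt /mem_set Tu; exact: rhoM.
(* [T] acts freely: cancel [s] on the right by [y]. *)
have free s t u : R s -> T t -> T u -> t * s = u * s -> t = u.
  move=> [_ [y sy]] Tt Tu /(congr1 (fun z => z * y)).
  by rewrite -!mulgA sy (T1 _ Tt).2 (T1 _ Tu).2.
pose orbit s := [set u | exists2 t, T t & u = t * s].
(* One representative per orbit: [xget] depends only on the orbit as a set. *)
pose r s := xget 1 (orbit s).
have /choice[k kP] : forall s, exists t, R s -> T t /\ r s = t * s.
  move=> s; have [[es sy]|nRs] := pselect (R s); last by exists 1.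
  have [|t Tt rs] := @xgetPex _ 1 (orbit s); first by exists s, e.
  by exists t.
pose lam0 s := (rho (k s))^-1.
have lam0M t s : T t -> R s -> lam0 (t * s) = rho t * lam0 s.
  move=> Tt Rs; have Rts : R (t * s).
    have [es [y sy]] := Rs; split; first by rewrite mulgA (T1 _ Tt).1.
    have [u Tu [tu ut]] := TV _ Tt.
    by exists (y * u); rewrite mulgA -(mulgA t) sy (T1 _ Tt).2.
  have rts : r (t * s) = r s.
    congr (xget 1 _); apply/seteqP; split=> _ [u Tu ->].
      by exists (u * t); [exact: TM|rewrite mulgA].
    have [v Tv [tv vt]] := TV _ Tt.
    exists (u * v); first exact: TM.
    by rewrite -mulgA (mulgA v) vt Rs.1.
  have [Tks ks] := kP _ Rs; have [Tkts kts] := kP _ Rts.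
  have : k (t * s) * t = k s.
    by apply: (free s) => //; [exact: TM|rewrite -mulgA -kts rts].
  by rewrite /lam0 => <-; rewrite rhoM'// invMg mulKVg.
have Re : R e by split; [exact: (T1 _ Te).1|exists e; exact: (T1 _ Te).1].
(* Normalize so that [e] goes to [1]. *)
exists (fun s => lam0 s * (lam0 e)^-1); rewrite mulgV; split=> // t s Tt Rs.
by rewrite lam0M// mulgA.
Qed.

(** With [lam] as in [equivariant_map], [(s, m) |-> lam(s)^-1 lam(s m)] is a
    cocycle on [M] with values in [B]: it gives the entries of a representation
    of [M] by monomial matrices over [B], and the entry at [e] of [t] in [T] is
    [rho(t)].  The cover consists of the elements of [M] with all lifts of their
    entries to [A].  Its subgroups over an idempotent embed in a power of the
    kernel of [alpha], and [psi] reads the entry at [e]. *)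
Lemma monomial_expansion (H : finGroupType -> Prop) (M : monoidType)
    (T : set M) (A B K : finGroupType) (rho : M -> B) (alpha : A -> B)
    (iota : K -> A) :
  pseudovariety_of_groups H -> arborescent H -> overline H M ->
  subgroup T -> {in T &, {morph rho : x y / x * y}} ->
  {morph alpha : x y / x * y} -> range alpha = [set: B] ->
  {morph iota : x y / x * y} -> injective iota ->
  range iota = alpha @^-1` [set 1] -> abelian [set: K]%SET -> H K ->
  exists (N : monoidType) (q : N -> M) (psi : N -> A),
    [/\ overline H N, monoid_morphism q, forall m, exists n, q n = m,
        forall x y, T (q x) -> T (q y) -> psi (x * y) = psi x * psi y &
        forall x, T (q x) -> alpha (psi x) = rho (q x)].
Proof.
move=> pvH arbH HM [TM [e Te [T1 TV]]] rhoM alM alR ioM ioI ioR abK HK.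
have rhoM' t u : T t -> T u -> rho (t * u) = rho t * rho u.
  by move=> /mem_set Tt /mem_set Tu; exact: rhoM.
have [lam [lame lamM]] := equivariant_map TM Te T1 TV rhoM.
set R := (X in forall t s, _ -> X s -> _) in lamM.
have al1 := morph_group1 alM.
(* The entry at [s] of a transformation [(s, a) |-> (s * m, a * c s)]. *)
pose c (t : M * A -> M * A) s := (t (s, 1)).2.
(* The second clause says that the entry at [s] lifts the one prescribed by
   [lam]; the third, that entries are invariant under [T] wherever [m] acts
   inside [R], which makes the entry at [e] multiplicative above [T]. *)
pose P m t := [/\ forall s a, t (s, a) = (s * m, a * c t s),
  forall s, alpha (c t s) = (lam s)^-1 * lam (s * m) &
  forall u s, T u -> R s -> R (s * m) -> c t (u * s) = c t s].
have RM s m : e * s = s -> R (s * m) -> R s.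
  by move=> es [_ [y smy]]; split=> //; exists (m * y); rewrite mulgA.
have cM m n t t' s : P m t -> P n t' -> c (t' \o t) s = c t s * c t' (s * m).
  by move=> [tE _ _] [t'E _ _]; rewrite /c /= tE t'E /= mul1g.
have P1 : P 1 id.
  split=> [s a|s|//]; first by rewrite /c !mulg1.
  by rewrite /c /= al1 mulg1 mulVg.
have PM m n t t' : P m t -> P n t' -> P (m * n) (t' \o t).
  move=> Pt Pt'; have [tE tal tT] := Pt; have [t'E t'al t'T] := Pt'.
  split=> [s a|s|u s Tu Rs].
  - by rewrite (cM _ _ _ _ _ Pt Pt') /= tE t'E !mulgA.
  - by rewrite (cM _ _ _ _ _ Pt Pt') alM tal t'al !mulgA mulgK.
  - rewrite !mulgA => Rsmn; have Rsm : R (s * m).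
      by apply: (RM _ n) => //; rewrite mulgA Rs.1.
    by rewrite !(cM _ _ _ _ _ Pt Pt') tT// -(mulgA u) (t'T u (s * m)).
pose E := expansion (ActionSpec P1 PM).
have EP (x : E) : P (base x) (act x) := expansionP x.
have TR t : T t -> R t.
  move=> Tt; split; first exact: (T1 _ Tt).1.
  by have [u _ [tu _]] := TV _ Tt; exists u.
have Re : R e := TR _ Te.
exists E, (@base _ _ _), (fun x => c (act x) e); split.
- apply: (@overline_extension H M E (@base _ _ _)) => //.
    apply: expansion_finite; first exact: HM.1.
    by rewrite -setXTT; apply: finite_setX; [exact: HM.1|exact: finite_finset].
  move=> S eps [SM [u Su [u1 _]]] Seps.
  have epsI : eps * eps = eps.
    rewrite -{1}(Seps _ Su) -{1}(Seps _ Su) -[LHS]/(base (u * u)).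
    by rewrite (u1 _ Su).1 Seps.
  (* Since [u] is a left identity of [S] lying over the idempotent [eps], an
     element of [S] is determined by its entries at the points [s * eps]; there
     they multiply componentwise and are in the kernel of [alpha]. *)
  pose d (x : E) s := c (act x) (s * eps).
  have dal x s : S x -> alpha (d x s) = 1.
    move=> Sx; have [_ -> _] := EP x.
    by rewrite (Seps _ Sx) -mulgA epsI mulVg.
  have dM x y s : S x -> d (x * y) s = d x s * d y s.
    move=> Sx; rewrite /d (cM _ _ _ _ _ (EP x) (EP y)).
    by rewrite (Seps _ Sx) -mulgA epsI.
  have dE x s a : S x -> act x (s, a) = (s * eps, a * c (act u) s * d x s).
    move=> Sx; rewrite -{1}(u1 _ Sx).1 actM.
    have [-> _ _] := EP u; have [-> _ _] := EP x.
    by rewrite (Seps _ Sx) (Seps _ Su) -mulgA epsI.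
  have /choice[kap kapK] : forall a, exists k, alpha a = 1 -> iota k = a.
    move=> a; have [a1|] := pselect (alpha a = 1); last by exists 1.
    have : range iota a by rewrite ioR.
    by move=> [k _ <-]; exists k.
  have [n [g gS]] := finite_enum HM.1.
  exists {dffun forall i : 'I_n, K}, (fun x => [ffun i => kap (d x (g i))]); split.
  + exact: pseudovariety_prod.
  + apply/centsP => x _ y _; apply/ffunP => i; rewrite !ffunE.
    by move/centsP: abK; apply; rewrite inE.
  + move=> x y /set_mem Sx /set_mem Sy; apply/ffunP => i; rewrite !ffunE.
    apply: ioI; rewrite ioM !kapK ?dM//; try exact: dal.
    by rewrite alM !dal// mulg1.
  + move=> x y /set_mem Sx /set_mem Sy /ffunP xy.
    apply: expansion_ext; first by rewrite !Seps.
    apply/funext => -[s a]; rewrite !dE//; congr (_, _ * _).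
    have [i <-] := gS s; have := xy i; rewrite !ffunE => /(congr1 iota).
    by rewrite !kapK//; exact: dal.
- exact: base_morphism.
- move=> m.
  have /choice[sig sigK] : forall b, exists a, alpha a = b.
    by move=> b; have : range alpha b by [|rewrite alR]; case=> a _ <-; exists a.
  pose t (sa : M * A) := (sa.1 * m, sa.2 * sig ((lam sa.1)^-1 * lam (sa.1 * m))).
  have ct s : c t s = sig ((lam s)^-1 * lam (s * m)) by rewrite /c /= mul1g.
  have [|x <- _] := @expansion_lift _ _ (ActionSpec P1 PM) m t; last by exists x.
  split=> [s a|s|v s Tv Rs Rsm]; rewrite !ct ?sigK//.
  by rewrite -(mulgA v) (lamM v s)// (lamM v (s * m))// invMg -!mulgA mulKg.
- move=> x y Tx Ty; rewrite (cM _ _ _ _ _ (EP x) (EP y)); congr (_ * _).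
  have [_ _ yT] := EP y.
  have [ex xe] := T1 _ Tx; have [ey _] := T1 _ Ty.
  by rewrite ex -{1}xe yT// ey; exact: TR.
- move=> x Tx; have [_ -> _] := EP x.
  rewrite lame invg1 mul1g (T1 _ Tx).1 -{1}(T1 _ Tx).2 lamM// lame mulg1.
  by [].
Qed.

(** * The counting cover *)

(** An automaton reads a word over [M] and greedily counts the disjoint factors
    of the word whose product is in [I]; the cover is made of the
    transformations that words may induce.  A group of such transformations
    over an idempotent cannot raise the counter, so it acts through [M] and is
    trivial. *)
Lemma counting_expansion (H : finGroupType -> Prop) (M : monoidType)
    (I : set M) (n : nat) :
  pseudovariety_of_groups H -> arborescent H -> overline H M ->
  (forall a b, I b -> I (a * b)) -> (forall a b, I a -> I (a * b)) ->
  exists (N : monoidType) (q : N -> M),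
    [/\ overline H N, monoid_morphism q, forall m, exists x, q x = m &
        forall x, ~ I (q x) -> I (q (x ^+ n)) -> x ^+ n * x ^+ n <> x ^+ n].
Proof.
move=> pvH arbH HM Il Ir.
pose Q : choiceType := (M * 'I_n.+2)%type.
(* A state [(s, i)] records that [i] disjoint factors in [I] have been read and
   that [s], which should lie outside [I], is the product of what followed the
   last of them.  Such a state is live until the count reaches [n + 1]; all
   other states are frozen. *)
pose live (z : Q) := z.2 < n.+1 /\ ~ I z.1.
(* A factor is cut off as soon as the current product falls into [I].  Reading
   [m] outside [I] yields at most one cut, and what remains after it is a right
   factor of [m]. *)
pose P (m : M) (t : Q -> Q) := [/\
  forall z, ~ live z -> t z = z,
  forall z, live z -> ~ I (z.1 * m) -> t z = (z.1 * m, z.2),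
  forall z, live z -> I (z.1 * m) ->
    z.2 < (t z).2 /\ ((t z).2 < n.+1 -> ~ I (t z).1) &
  forall z, live z -> I (z.1 * m) -> ~ I m ->
    (t z).2 = z.2.+1 :> nat /\ (live (t z) -> exists a : M, m = a * (t z).1)].
have Pmono m t (z : Q) : P m t -> z.2 <= (t z).2.
  move=> [t0 t1 t2 _]; have [lz|nlz] := pselect (live z); last by rewrite t0.
  have [Izm|nIzm] := pselect (I (z.1 * m)); last by rewrite t1.
  by have [/ltnW] := t2 z lz Izm.
have P1 : P 1 id.
  by split=> // -[s i] [/= i_lt sI]; rewrite mulg1.
have PM m n' t t' : P m t -> P n' t' -> P (m * n') (t' \o t).
  move=> Pt Pt'; have [t0 t1 t2 t3] := Pt; have [t'0 t'1 t'2 t'3] := Pt'.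
  have live1 (z : Q) : live z -> ~ I (z.1 * m) -> live (t z).
    by move=> lz nI; rewrite t1//; split=> //; exact: lz.1.
  split=> z lz /=.
  - by rewrite t0// t'0.
  - move=> nI; have nIm : ~ I (z.1 * m) by move=> /Ir Im; apply: nI; rewrite mulgA.
    have := live1 z lz nIm; rewrite t1// => lz'.
    by rewrite t'1//= -mulgA.
  - move=> Imn; have [Im|nIm] := pselect (I (z.1 * m)).
      have [ztz good] := t2 z lz Im.
      split; first exact: leq_trans ztz (Pmono _ _ _ Pt').
      have [ltz|nltz] := pselect (live (t z)); last by rewrite t'0.
      have [Imn'|nImn'] := pselect (I ((t z).1 * n')); last by rewrite t'1.
      by have [] := t'2 _ ltz Imn'.
    have := live1 z lz nIm; rewrite t1// => lz'.
    by have := t'2 _ lz' => /=; rewrite -mulgA; exact.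
  - move=> Imn nImn.
    have nIm : ~ I m by move=> /Ir.
    have nIn : ~ I n' by move=> /Il.
    have [Im|nIzm] := pselect (I (z.1 * m)).
      have [tz2 tzl] := t3 z lz Im nIm.
      have [ltz|nltz] := pselect (live (t z)); last by rewrite t'0.
      have [a ma] := tzl ltz.
      rewrite t'1//=; last by move=> /(Il a); rewrite mulgA -ma.
      by split=> // _; exists a; rewrite mulgA -ma.
    have := live1 z lz nIzm; rewrite t1// => lz'.
    have [|//|/= -> zl] := t'3 _ lz'; first by rewrite /= -mulgA.
    by split=> // /zl[a na]; exists (m * a); rewrite -mulgA -na.
pose E := expansion (ActionSpec P1 PM).
have EP (x : E) : P (base x) (act x) := expansionP x.
exists E, (@base _ _ _); split.
- apply: (@overline_extension H M E (@base _ _ _)) => //.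
    apply: expansion_finite; first exact: HM.1.
    by rewrite -setXTT; apply: finite_setX; [exact: HM.1|exact: finite_finset].
  move=> S eps [SM [u Su [u1 _]]] Seps.
  (* The image of the identity [u] consists of frozen states and of states on
     which nothing is cut, where the action is forced by [eps]. *)
  have Su_eq x : S x -> x = u.
    move=> Sx; apply: expansion_ext; first by rewrite !Seps.
    apply/funext => z; rewrite -{1}(u1 _ Sx).1 actM.
    have uz : act u (act u z) = act u z by rewrite -actM (u1 _ Su).1.
    have [u_0 u_1 u_2 _] := EP u; have [x0 x1 _ _] := EP x.
    have [lz|nlz] := pselect (live (act u z)); last by rewrite x0.
    have nI : ~ I ((act u z).1 * eps).
      by rewrite -(Seps _ Su) => /(u_2 _ lz)[]; rewrite uz ltnn.
    by rewrite x1 ?(Seps _ Sx)// -[RHS]uz (u_1 _ lz) ?(Seps _ Su)//.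
  exists {dffun forall i : 'I_0, 'S_0}, (fun=> 1); split.
  + by apply: pseudovariety_prod => // -[].
  + by apply/centsP => x _ y _; apply/ffunP => -[i i0]; exfalso; rewrite ltn0 in i0.
  + by move=> x y _ _; rewrite mulg1.
  + by move=> x y /set_mem Sx /set_mem Sy _; rewrite (Su_eq x)// (Su_eq y).
- exact: base_morphism.
- move=> m.
  pose t (z : Q) : Q := if pselect (live z) then
    if pselect (I (z.1 * m)) then (1, inord z.2.+1) else (z.1 * m, z.2) else z.
  have [|x <- _] := @expansion_lift _ _ (ActionSpec P1 PM) m t; last by exists x.
  have inz (z : Q) : live z -> (inord z.2.+1 : 'I_n.+2) = z.2.+1 :> nat.
    by move=> [zn _]; rewrite inordK.
  split=> z lz; rewrite /t; case: pselect => //= _.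
  + by case: pselect.
  + case: pselect => //= _ _; rewrite inz//; split=> // _ I1; apply: lz.2.
    by rewrite -(mulg1 z.1); exact: Il.
  + case: pselect => //= _ _ _; rewrite inz//; split=> // _.
    by exists m; rewrite mulg1.
- move=> x nIx Ixn xx.
  have nI1 : ~ I 1 by move=> I1; apply: nIx; rewrite -(mulg1 (base x)); exact: Il.
  (* Starting at [z0], [x ^+ n] cuts at most [n] times, so it ends in a live
     state; a second pass of [x ^+ n] strictly raises the count. *)
  pose z0 : Q := (1, ord0).
  have lz0 : live z0 by [].
  have rank j : (act (x ^+ j) z0).2 <= j.
    elim: j => [//|j IHj]; rewrite expgSr actM.
    move: (act _ z0) IHj => z zj.
    have [x0 x1 _ x3] := EP x.
    have [lz|nlz] := pselect (live z); last by rewrite x0// leqW.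
    have [Iz|nIz] := pselect (I (z.1 * base x)); last by rewrite x1// leqW.
    by have [-> _] := x3 z lz Iz nIx.
  have [_ _ y2 _] := EP (x ^+ n).
  have [_ /(_ (rank n)) nI] : _ := y2 z0 lz0 (Il _ _ Ixn).
  have lz : live (act (x ^+ n) z0) by split=> //; exact: rank.
  have [] := y2 _ lz (Il _ _ Ixn).
  by rewrite -actM xx ltnn.
Qed.

(** * Reduction of embedding problems to abelian kernels *)

Lemma card_subg_of (G : finGroupType) (L : {group G}) : #|subg_of L| = #|L|.
Proof. exact: card_sub. Qed.

Lemma quotient_setT (G : finGroupType) (Z : {group G}) :
  ([set: G]%SET / Z)%g = [set: coset_of Z]%SET.
Proof.
apply/finset.setP => u; rewrite [RHS]inE; have [x nZx ->] := cosetP u.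
by rewrite mem_quotient ?inE.
Qed.

(** The extension of [G / Z] by [Z], in the form used by [arborescent]. *)
Lemma coset_exact (G : finGroupType) (Z : {group G}) : (Z <| [set: G]%SET)%g ->
  [/\ {morph coset Z : x y / x * y}, range (coset Z) = [set: coset_of Z] &
      range (@sgval G Z) = coset Z @^-1` [set 1]].
Proof.
move=> /andP[_ /fintype.subsetP nZ].
have nZ' x : x \in 'N(Z)%g by apply: nZ; rewrite inE.
split=> [x y||]; first by rewrite morphM.
- apply/seteqP; split=> // u _; have [x _ ->] := cosetP u; by exists x.
- apply/seteqP; split=> [_ [u _ <-]|x /= xZ]; first exact/coset_id/subgP.
  have Zx : x \in Z by exact: coset_idr.
  by exists (Subg Zx).
Qed.

(** [H] contains the group of order [p], a subgroup of [B]; induction on the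
    order, splitting off a subgroup of order [p]. *)
Lemma abelian_pgroup_closed (H : finGroupType -> Prop) (B : finGroupType) p :
  pseudovariety_of_groups H -> arborescent H -> H B -> prime p -> p %| #|B| ->
  forall Z : finGroupType, abelian [set: Z]%SET -> p.-group [set: Z]%SET -> H Z.
Proof.
move=> pvH arbH HB p_pr pB Z.
have [n] := ubnP #|Z|; elim: n Z => // n IHn Z /ltnSE Zn abZ pZ.
have [Z1|ntZ] := eqVneq [set: Z]%SET 1%g.
  have Z1' x : x = 1 :> Z by apply/set1gP; rewrite -Z1 inE.
  apply: (pseudovariety_inj (j := fun=> 1 : B)) HB => //.
    by move=> x y; rewrite mulg1.
  by move=> x y _; rewrite (Z1' x) (Z1' y).
have [_ pcZ _] := pgroup_pdiv (pZ : p.-group [set: Z]%G) ntZ.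
have [x _ ox] := Cauchy p_pr (pcZ : p %| #|[set: Z]%G|).
have [y _ oy] : {y | y \in [set: B]%G & #[y]%g = p}.
  by apply: Cauchy; rewrite //= cardsT.
pose C := <[x]>%G.
have nC : (C <| [set: Z]%SET)%g.
  rewrite /normal finset.subsetT /= sub_abelian_norm ?finset.subsetT//.
have [cM cR cK] := coset_exact nC.
apply: (arbH (subg_of C) Z (coset_of C) sgval (coset C)) => //.
- exact: subg_inj.
- apply/centsP => u _ v _; apply: subg_inj.
  by move/centsP: abZ; apply; rewrite inE.
- have /isogP[f fI _] : C \isog <[y]>%G.
    by rewrite isog_cyclic_card ?cycle_cyclic//= -!orderE ox oy eqxx.
  apply: (pseudovariety_inj (j := fun u : subg_of C => f (sgval u))) HB => //.
    by move=> u v /=; rewrite morphM ?subgP.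
  by move=> u v /(injmP fI) uv; apply/subg_inj/uv; exact: subgP.
- apply: IHn.
  + apply: leq_trans Zn; rewrite -[X in X < _]cardsT -quotient_setT -[X in _ < X]cardsT.
    apply: ltn_quotient; last exact: finset.subsetT.
    by rewrite -cardG_gt1 -orderE ox prime_gt1.
  + by rewrite -quotient_setT quotient_abelian.
  + by rewrite -quotient_setT quotient_pgroup.
Qed.

(** Induction on the order of [A].  In a minimal counterexample no proper
    subgroup of [A] maps onto [B], so the Sylow subgroups of the kernel are
    normal in [A]; let [Z] be the center of a nontrivial one.  First lift to [A / Z], then to [A] by the
    abelian case.  That [Z] is in [H] holds because [p] divides the order of
    [A / Z], a quotient of [G] and so a member of [H]. *)
Lemma projective_of_abelian (H : finGroupType -> Prop) (G : preTopologicalGroupType) :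
  pseudovariety_of_groups H -> arborescent H ->
  (forall (B : finGroupType) (phi : G -> B),
     {morph phi : x y / x * y} -> range phi = [set: B] ->
     continuous (phi : G -> discrete_topology B) -> H B) ->
  (forall (A B K : finGroupType) (alpha : A -> B) (iota : K -> A) (phi : G -> B),
     {morph alpha : x y / x * y} -> range alpha = [set: B] ->
     {morph iota : x y / x * y} -> injective iota ->
     range iota = alpha @^-1` [set 1] -> abelian [set: K]%SET -> H K ->
     {morph phi : x y / x * y} ->
     continuous (phi : G -> discrete_topology B) ->
     exists psi : G -> A,
       [/\ {morph psi : x y / x * y},
           continuous (psi : G -> discrete_topology A) &
           alpha \o psi = phi]) ->
  projective_group G.
Proof.
move=> pvH arbH quotH liftab A.
have [n] := ubnP #|A|; elim: n A => // n IHn A /ltnSE An B alpha phi alM alR phiM phiR phiC.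
have alS b : exists a, alpha a = b.
  by have : range alpha b by [|rewrite alR]; case=> a _ <-; exists a.
(* If a proper subgroup of [A] already maps onto [B], lift to it instead. *)
have [[L [LS Ln]]|Lmin] := pselect (exists L : {group A},
    (forall b, exists2 a, a \in L & alpha a = b) /\ #|L| < #|A|).
  have [||||||psi [psiM psiC psiE]] := IHn (subg_of L) _ B (alpha \o sgval) phi => //.
  - by rewrite card_subg_of; exact: leq_trans Ln An.
  - by move=> x y /=; rewrite alM.
  - by apply/seteqP; split=> // b _; have [a La <-] := LS b; exists (Subg La).
  exists (sgval \o psi); split=> [x y /=||]; first by rewrite psiM.
    apply/discrete_continuousP => U.
    by move/discrete_continuousP: psiC => /(_ (sgval @^-1` U)).
  by rewrite -psiE.
have full (L : {group A}) : (forall b, exists2 a, a \in L & alpha a = b) ->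
    forall a, a \in L.
  move=> LS a; have /eqP -> : L == [set: A]%SET :> {set A}; last by rewrite inE.
  rewrite eqEcard finset.subsetT cardsT leqNgt; apply/negP => Ln; by apply: Lmin; exists L.
pose am : {morphism [set: A]%SET >-> B} := @Morphism _ _ [set: A]%SET _ (in2W alM).
pose K := ('ker am)%G.
have KP a : (a \in K) = (alpha a == 1) by rewrite !inE.
have nK : (K <| [set: A]%SET)%g by exact: ker_normal.
have al1 := morph_group1 alM.
have alV a : alpha a^-1 = (alpha a)^-1 by rewrite -[LHS]/(am a^-1) morphV ?inE.
have [K1|ntK] := eqVneq (K : {set A}) 1%g.
  have alI : injective alpha.
    move=> a a' aa'; apply/eqP; rewrite eq_mulgV1; apply/eqP/set1gP.
    by rewrite -K1 KP alM alV aa' mulgV.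
  have /choice[s sK] := alS.
  exists (s \o phi); split=> [x y /=||]; first by apply: alI; rewrite alM !sK.
    apply/discrete_continuousP => U.
    by move/discrete_continuousP: phiC => /(_ (s @^-1` U)).
  by apply/funext => x /=.
have [p p_pr pK] : exists2 p, prime p & p %| #|K|.
  by exists (pdiv #|K|); [apply: pdiv_prime; rewrite cardG_gt1|exact: pdiv_dvd].
(* By the Frattini argument and minimality, the Sylow subgroup [P] of the
   kernel is normal in [A]; its center is then a nontrivial normal abelian
   [p]-subgroup through which the problem is split in two. *)
have [P sylP] := Sylow_exists p K.
have nP a : a \in 'N(P)%g.
  have : a \in 'N_([set: A]%SET)(P)%G; last by case/finset.setIP.
  apply: full => b; have [a' <-] := alS b.
  have : a' \in (K * 'N_([set: A]%SET)(P))%g by rewrite (Frattini_arg nK sylP) inE.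
  case/mulsgP => k m; rewrite KP => /eqP k1 Nm ->.
  by exists m => //; rewrite alM k1 mul1g.
have pP : p.-group P by exact: pHall_pgroup sylP.
pose Z := 'Z(P)%G.
have nZ : (Z <| [set: A]%SET)%g.
  apply: char_normal_trans (center_char P) _.
  by rewrite /normal finset.subsetT; apply/fintype.subsetP => a _.
have ZK a : a \in Z -> alpha a = 1.
  move=> Za; apply/eqP; rewrite -KP; apply: (fintype.subsetP (pHall_sub sylP)).
  exact: (fintype.subsetP (center_sub P)).
have ntZ : Z != 1%g :> {set A}.
  apply/eqP => /(trivg_center_pgroup pP) P1.
  have := card_Hall sylP; rewrite P1 cards1 => /esym/eqP.
  by rewrite p_part_eq1 mem_primes p_pr cardG_gt0 pK.
have pZ : p.-group Z by apply: pgroupS pP; exact: center_sub.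
have [cM cR cK] := coset_exact nZ.
pose beta (u : coset_of Z) := alpha (repr u).
have betaE a : beta (coset Z a) = alpha a.
  have : repr (coset Z a) * a^-1 \in Z.
    apply: coset_idr; first by apply: (fintype.subsetP (normal_norm nZ)); rewrite inE.
    by rewrite cM coset_reprK -cM mulgV -[RHS](morph_group1 cM).
  by move=> /ZK; rewrite alM alV => /eqP; rewrite -eq_mulgV1 => /eqP.
have cS u : exists a, coset Z a = u.
  by have : range (coset Z) u by [|rewrite cR]; case=> a _ <-; exists a.
have [||||||phi1 [phi1M phi1C phi1E]] := IHn (coset_of Z) _ B beta phi.
- apply: leq_trans An; rewrite -[X in X < _]cardsT -quotient_setT -[X in _ < X]cardsT.
  by apply: ltn_quotient; last exact: finset.subsetT.
- move=> u v; have [a <-] := cS u; have [b <-] := cS v.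
  by rewrite -cM !betaE alM.
- by apply/seteqP; split=> // b _; have [a <-] := alS b; exists (coset Z a).
- exact: phiM.
- exact: phiR.
- exact: phiC.
(* The preimage in [A] of the range of [phi1] maps onto [B], hence is [A]. *)
have phi1R : range phi1 = [set: coset_of Z].
  apply/seteqP; split=> // u _.
  pose L := [set a | `[< range phi1 (coset Z a) >]]%SET.
  have LG : group_set L.
    apply/group_setP; split=> [|a b].
      rewrite !inE; exists 1 => //.
      by rewrite (morph_group1 phi1M) (morph_group1 cM).
    rewrite !inE => -[x _ xa] [y _ yb].
    rewrite cM -xa -yb -phi1M; by exists (x * y).
  have [a au] := cS u.
  have : a \in Group LG.
    apply: full => b.
    have : range phi b by rewrite phiR.
    case=> x _ <-; have [a' a'x] := cS (phi1 x).
    exists a'; first by rewrite !inE; exists x.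
    by rewrite -betaE a'x -phi1E.
  by rewrite !inE au.
have HcZ : H (coset_of Z) := quotH _ _ phi1M phi1R phi1C.
(* Otherwise [Z] has a complement by Schur-Zassenhaus; it maps onto [B]. *)
have pcZ : p %| #|{: coset_of Z}|.
  rewrite -cardsT -quotient_setT card_quotient ?normal_norm//.
  apply/negPn/negP => npZ.
  have /SchurZassenhaus_split/(_ nZ)/splitsP[L /complP[ZL ZLA]] : Hall [set: A]%G Z.
    rewrite /Hall finset.subsetT /=; have [_ _ [m ->]] := pgroup_pdiv pZ ntZ.
    by rewrite coprimeXl// prime_coprime.
  have LA a : a \in L.
    apply: full => b; have [a' <-] := alS b.
    have : a' \in (Z * L)%g by rewrite ZLA inE.
    by case/mulsgP => z l /ZK z1 Ll ->; exists l => //; rewrite alM z1 mul1g.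
  case/negP: ntZ; rewrite -subG1 -ZL finset.subsetI subxx /=; exact/fintype.subsetP.
have abZ : abelian [set: subg_of Z]%SET.
  apply/centsP => u _ v _; apply: subg_inj.
  by move/centsP: (center_abelian P) => /(_ _ (subgP u) _ (subgP v)).
have HZ : H (subg_of Z).
  apply: (abelian_pgroup_closed pvH arbH HcZ p_pr pcZ) => //.
  by rewrite /pgroup cardsT card_subg_of.
have [psi [psiM psiC psiE]] :=
  liftab A (coset_of Z) (subg_of Z) (coset Z) sgval phi1 cM cR
    (fun _ _ => erefl) (@subg_inj _ _) cK abZ HZ phi1M phi1C.
exists psi; split=> //; apply/funext => x /=.
by rewrite -betaE -phi1E -psiE.
Qed.

(** * Closed subgroups are projective profinite groups *)

Section ClosedSubgroup.
Variables (V : monoidType -> Prop) (F : preTopologicalMonoidType).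
Variables (D : proj_system V) (f : forall i : ps_index D, F -> ps_obj i).
Hypothesis fcone : pro_cone f.
Variables (S : set F) (gS : subgroup S).

Let fM i : {morph f i : x y / x * y} := (cone_morphism fcone i).2.

(** [S] is the limit of its images in the finite levels: a compatible family in
    these images is a point of [F] adherent to [S], hence in [S]. *)
Lemma closed_subgroup_profinite :
  (forall M : monoidType, V M -> finite_set [set: M]) -> closed S ->
  profinite_group (subgroup_type gS).
Proof.
move=> Vfin clS.
pose gT i := subgroup_image (@fM i) gS.
pose T i := subgroup_type (gT i).
have mapT i j (ij : ps_le i j) x : (f j @` S) x -> (f i @` S) (ps_map ij x).
  by move=> [y Sy <-]; exists y; rewrite ?(cone_compatible fcone).
have finT i : finite_group (T i).
  split; last by move=> x; exists x^-1; rewrite mulgV mulVg.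
  apply: (@finite_inj _ (ps_obj i) (@sgincl _ _ (gT i))).
    exact: sgincl_inj.
  exact: Vfin (ps_objP i).
pose tmap i j (ij : ps_le i j) : T j -> T i := sgrestrict (gT i) (mapT i j ij).
have tmapM i j (ij : ps_le i j) : monoid_morphism (tmap i j ij).
  have tM : {morph tmap i j ij : x y / x * y}.
    by move=> x y; apply: val_inj; exact: (ps_mapM ij).2.
  by split=> //; exact: morph_group1 tM.
have tmap_id i ii x : tmap i i ii x = x.
  by apply: sgincl_inj; exact: ps_map_id.
have tmap_comp i j k ij jk ik x : tmap i j ij (tmap j k jk x) = tmap i k ik x.
  by apply: sgincl_inj; exact: ps_map_comp.
pose D' : proj_system finite_group := {|
  ps_index := ps_index D; ps_le := @ps_le _ D;
  ps_inhabited := ps_inhabited D; ps_refl := @ps_refl _ D;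
  ps_trans := @ps_trans _ D; ps_directed := @ps_directed _ D;
  ps_obj := T; ps_objP := finT; ps_map := tmap; ps_mapM := tmapM;
  ps_map_id := tmap_id; ps_map_comp := tmap_comp |}.
have fST i x : S x -> (f i @` S) (f i x) by exists x.
pose g i : subgroup_type gS -> T i := sgrestrict (gT i) (fST i).
have gE i x : sgincl (g i x) = f i (sgincl x) by [].
have gM i : {morph g i : x y / x * y}.
  by move=> x y; apply: sgincl_inj; rewrite sginclM !gE sginclM fM.
have gcone : @pro_cone finite_group (subgroup_type gS) D' g.
  split=> [i|x y gxy|i j ij x|t tC|U].
  - by split; [exact: (morph_group1 (@gM i))|exact: gM].
  - apply: sgincl_inj; apply: (cone_separated fcone) => i.
    by rewrite -!gE gxy.
  - by apply: val_inj; exact: (cone_compatible fcone).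
  - have [|x xt] := cone_complete fcone (t := fun i => sgincl (t i)).
      by move=> i j ij; rewrite -(tC _ _ ij).
    (* If [x] were not in [S], a whole fibre of some [f i] through [x] would
       miss [S], although [f i x] comes from [S]. *)
    have Sx : S x.
      apply: contrapT => nSx.
      have /(cone_open fcone)/(_ x nSx)[i iS] : open (~` S) by exact: closed_openC.
      by have [y Sy yt] := sginclP (t i); apply: (iS y) => //; rewrite xt.
    have [u ux] := @sgincl_onto _ _ gS x Sx.
    by exists u => i; apply: sgincl_inj; rewrite gE ux xt.
  - split=> [[W /(cone_open fcone) oW <-] x Wx|Uloc].
      have [i iW] := oW _ Wx.
      by exists i => y /(congr1 (@sgincl _ _ _)) yx; exact: iW.
    apply/subgroup_openP.
    exists [set z | exists x i, (forall y, g i y = g i x -> U y) /\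
                                f i z = f i (sgincl x)].
      apply/(cone_open fcone) => z [x [i [iU zx]]].
      by exists i => y yz; exists x, i; rewrite yz.
    apply/seteqP; split=> [z [x [i [iU zx]]]|x Ux].
      by apply: iU; apply: sgincl_inj; rewrite !gE.
    by have [i iU] := Uloc x Ux; exists x, i.
split; first by apply/proP; exists D', g.
apply/continuousP => U /(cone_open gcone) Uloc; apply/(cone_open gcone) => x Ux.
have [i iU] := Uloc _ Ux; exists i => y yx; apply: iU.
by rewrite !(morph_groupV (@gM i)) yx.
Qed.


Lemma subgroup_factor (B : groupType) (phi : subgroup_type gS -> B) :
  {morph phi : x y / x * y} -> continuous (phi : _ -> discrete_topology B) ->
  exists i (rho : ps_obj i -> B), {in f i @` S &, {morph rho : x y / x * y}} /\
    forall x, rho (f i (sgincl x)) = phi x.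
Proof.
move=> phiM /discrete_continuousP phiO.
have /subgroup_openP[W /(cone_open fcone) oW Wker] := phiO [set 1].
(* The kernel of [phi] contains a fibre of some [f i] around [1]. *)
have ker x : W (sgincl x) <-> phi x = 1.
  by rewrite -[W _]/((@sgincl _ _ gS @^-1` W) x) Wker.
have [i iW] := oW _ ((ker 1).2 (morph_group1 phiM)).
have fphi x y : f i (sgincl x) = f i (sgincl y) -> phi x = phi y.
  move=> fxy; apply: (mulgI (phi x^-1)); rewrite -!phiM mulVg.
  apply/esym; rewrite [RHS](morph_group1 phiM); apply/ker/iW.
  by rewrite sginclM fM -fxy -fM -sginclM mulVg.
have /choice[rho rhoE] : forall m, exists b,
    forall x : subgroup_type gS, f i (sgincl x) = m -> phi x = b.
  move=> m; have [[x xm]|nx] :=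
    pselect (exists x : subgroup_type gS, f i (sgincl x) = m).
    by exists (phi x) => y; rewrite -xm => /fphi.
  by exists 1 => x fx; case: nx; exists x.
have rhoE' x : rho (f i (sgincl x)) = phi x by rewrite -(rhoE _ x).
exists i, rho; split=> //.
move=> _ _ /set_mem[x Sx <-] /set_mem[y Sy <-].
have [u <-] := @sgincl_onto _ _ gS x Sx; have [v <-] := @sgincl_onto _ _ gS y Sy.
by rewrite -fM -sginclM !rhoE' phiM.
Qed.

End ClosedSubgroup.

(** To solve an embedding problem with abelian kernel, factor [phi] through a
    finite level, replace that level by its monomial cover, lift [F] to the
    cover and apply [psi]. *)
Lemma subgroup_projective (H : finGroupType -> Prop) (F : preTopologicalMonoidType)
    (S : set F) (gS : subgroup S) :
  pseudovariety_of_groups H -> arborescent H ->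
  pro (overline H) F -> lifts (overline H) F -> projective_group (subgroup_type gS).
Proof.
move=> pvH arbH /proP[D [f fcone]] liftF.
have fM i : {morph f i : x y / x * y} := (cone_morphism fcone i).2.
apply: (projective_of_abelian pvH arbH).
  move=> B phi phiM phiR phiC.
  have [i [rho [rhoM rhoE]]] := subgroup_factor fcone phiM phiC.
  have [_ /(_ _ (subgroup_image (fM i) gS))[G HG [h [[h' hK h'K] hM]]]] := ps_objP i.
  apply: (pseudovariety_image pvH (f := fun g => rho (sgincl (h g)))) HG.
    by move=> x y; rewrite hM sginclM rhoM// ?mem_set//; exact: sginclP.
  apply/seteqP; split=> // b _.
  have : range phi b by rewrite phiR.
  case=> x _ <-.
  have [|u ux] := @sgincl_onto _ _ (subgroup_image (fM i) gS) (f i (sgincl x)).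
    by exists (sgincl x) => //; exact: sginclP.
  by exists (h' u) => //; rewrite h'K ux rhoE.
move=> A B K alpha iota phi alM alR ioM ioI ioR abK HK phiM phiC.
have [i [rho [rhoM rhoE]]] := subgroup_factor fcone phiM phiC.
have gT := subgroup_image (fM i) gS.
have [N [q [psi [HN qM qS psiM psiE]]]] :=
  monomial_expansion pvH arbH (ps_objP i) gT rhoM alM alR ioM ioI ioR abK HK.
have [g [gM gC gE]] := liftF _ _ q (f i) (ps_objP i) HN qM qS
  (cone_morphism fcone i) (cone_continuous fcone).
have Tg (x : subgroup_type gS) : (f i @` S) (q (g (sgincl x))).
  by rewrite gE; exists (sgincl x) => //; exact: sginclP.
exists (fun x => psi (g (sgincl x))); split=> [x y||].
- by rewrite sginclM gM.2 psiM.
- apply/discrete_continuousP => U; apply/subgroup_openP.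
  exists (g @^-1` (psi @^-1` U)) => //.
  by move/discrete_continuousP: gC => /(_ (psi @^-1` U)).
- by apply/funext => x /=; rewrite psiE// gE rhoE.
Qed.

(** * Finite subsemigroups are bands *)

Lemma idempotent_power (M : monoidType) (S : set M) x :
  finite_set S -> subsemigroup S -> S x ->
  exists n, x ^+ n.+1 * x ^+ n.+1 = x ^+ n.+1.
Proof.
move=> finS SM Sx.
have Sxn n : S (x ^+ n.+1).
  elim: n => [|n IHn]; first by rewrite expg1.
  by rewrite expgS; exact: SM.
have [i [d xid]] : exists i d, x ^+ (i.+1 + d.+1) = x ^+ i.+1.
  apply: contrapT => nE; apply: infinite_nat.
  have -> : [set: nat] = (fun n => x ^+ n.+1) @^-1` S.
    by apply/seteqP; split=> n _; [exact: Sxn|].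
  apply: finite_preimage finS => i j _ _ xij; apply: contrapT => /eqP.
  rewrite neq_ltn => /orP[] ltij; apply: nE.
    by exists i, (j - i.+1); rewrite addnS subnKC// -xij.
  by exists j, (i - j.+1); rewrite addnS subnKC// xij.
have step m : x ^+ (i.+1 + m + d.+1) = x ^+ (i.+1 + m).
  by rewrite addnAC expgnDr xid -expgnDr.
have loop k m : x ^+ (i.+1 + m + k * d.+1) = x ^+ (i.+1 + m).
  elim: k => [|k IHk]; first by rewrite mul0n addn0.
  by rewrite mulSnr !addnA -(addnA i.+1) step addnA IHk.
exists (i.+1 * d.+1).-1; rewrite prednK ?muln_gt0// -expgnDr.
by have := loop i.+1 (i.+1 * d.+1 - i.+1); rewrite subnKC ?leq_pmulr.
Qed.

(** An element of the ideal generated by its idempotent power lies in a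
    subgroup; this is the stability of Green's relations in finite monoids. *)
Lemma power_factor_stable (M : monoidType) (z a b : M) n :
  finite_set [set: M] -> z ^+ n.+1 * z ^+ n.+1 = z ^+ n.+1 ->
  z = a * z ^+ n.+1 * b -> z ^+ n.+1 * z = z.
Proof.
move=> finM zz zab; have [c cE] : exists c, c = z ^+ n * b by exists (z ^+ n * b).
have azc : a * z * c = z by rewrite cE mulgA -(mulgA a) -expgS -zab.
(* Taking [c ^+ j] idempotent in [z = a^j z c^j] gives [z c^j = z]. *)
have zE j : z = a ^+ j * z * c ^+ j.
  elim: j => [|j IHj]; first by rewrite mul1g mulg1.
  rewrite expgSr (expgS c) !mulgA -(mulgA (a ^+ j) a z).
  by rewrite -(mulgA (a ^+ j) (a * z) c) azc.
have [//|//|j cc] := idempotent_power (x := c) finM.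
have zc : z * c ^+ j.+1 = z by rewrite (zE j.+1) -mulgA cc.
have zf : z = z ^+ n.+1 * (b * c ^+ j).
  by rewrite -[LHS]zc (expgS c) (expgS z) {1}cE !mulgA.
by rewrite {2}zf mulgA zz -zf.
Qed.

(** Lift an isomorphism of the group, of order [m], with Z/m along the
    projection from Z/m^2: the generator has order dividing [m] but goes to an
    element congruent to [1] modulo [m], which has order [m^2]. *)
Lemma projective_cyclic_trivial (F : preTopologicalMonoidType) (S : set F)
    (gS : subgroup S) (x : F) :
  finite_set S -> (forall T, T `<=` S -> closed T) ->
  projective_group (subgroup_type gS) -> S x ->
  (forall y, S y -> exists n, y = x ^+ n.+1) -> x * x = x.
Proof.
move=> finS clS projS Sx xS.
have [|K [f [[h fK hK] fM]]] := @finGroup_of (subgroup_type gS).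
  have -> : [set: subgroup_type gS] = @sgincl _ _ gS @^-1` S.
    by apply/seteqP; split=> // u _; exact: sginclP.
  by apply: finite_preimage finS => u v _ _; exact: sgincl_inj.
have hM : {morph h : u v / u * v}.
  by move=> u v; apply: (can_inj fK); rewrite fM !hK.
have [u ux] := @sgincl_onto _ _ gS x Sx.
have sginclX n : sgincl (u ^+ n.+1) = x ^+ n.+1.
  elim: n => [|n IHn]; first by rewrite !expg1.
  by rewrite expgS sginclM IHn ux -expgS.
pose g := h u; pose m := #[g].
have m_gt0 : 0 < m by exact: order_gt0.
have gmm : g ^+ (m * m) = 1 by rewrite expgnA expg_order expg1n.
have mmE : (m * m).-1.+1 = (m * m)%N by rewrite prednK// muln_gt0 m_gt0.
have gmod k : g ^+ (k %% (m * m).-1.+1) = g ^+ k by rewrite expg_mod ?mmE.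
(* [m * m] is positive, so these ordinals are the additive group Z/m^2. *)
pose alpha (a : 'I_(m * m).-1.+1) : K := g ^+ a.
have alM : {morph alpha : a b / a * b}.
  by move=> a b; rewrite /alpha /= gmod expgnDr.
have alR : range alpha = [set: K].
  apply/seteqP; split=> // k _; have [n kn] := xS _ (sginclP (f k)).
  exists (inZp n.+1) => //; rewrite /alpha /= gmod.
  by rewrite -(morph_groupX _ hM) -[RHS]fK; congr h; apply: sgincl_inj; rewrite sginclX.
have hR : range h = [set: K].
  by apply/seteqP; split=> // k _; exists (f k).
have hC : continuous (h : _ -> discrete_topology K).
  apply/discrete_continuousP => U; apply/subgroup_openP.
  exists (~` (@sgincl _ _ gS @` (h @^-1` ~` U))).
    by apply: closed_openC; apply: clS => _ [v _ <-]; exact: sginclP.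
  apply/seteqP; split=> [v nUv|v Uv [w nUw /sgincl_inj wv]].
    by apply: contrapT => nU; apply: nUv; exists v.
  by apply: nUw; rewrite /= wv.
have [psi [psiM _ psiE]] := projS _ K alpha h alM alR hM hR hC.
have alpsi : g ^+ psi u = g ^+ 1 by have := congr1 (fun k => k u) psiE.
have um1 : u ^+ m = 1.
  by apply: (can_inj hK); rewrite (morph_groupX _ hM) expg_order (morph_group1 hM).
have m1 : m %| 1.
  have : psi u ^+ m = 1 by rewrite -(morph_groupX _ psiM) um1 (morph_group1 psiM).
  rewrite Zp_expg => /(congr1 val) /= /eqP.
  move: (psi u : nat) alpsi => a alpsi.
  rewrite -/(dvdn _ _) mmE dvdn_pmul2r// => mpsi.
  move/eqP: alpsi; rewrite eq_expg_mod_order -/m => /eqP psi1.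
  by rewrite /dvdn -psi1.
have u1 : u = 1.
  apply: (can_inj hK); rewrite (morph_group1 hM) -/g.
  by apply/eqP; rewrite -order_eq1 -/m -dvdn1.
by rewrite -ux -sginclM u1 mulg1.
Qed.

(** The counting cover shows that [x] is in the ideal of its idempotent power
    in every finite level, so that the powers of [x] form a finite group, which
    is projective and hence trivial. *)
Lemma finite_subsemigroup_band (H : finGroupType -> Prop)
    (F : preTopologicalMonoidType) (S : set F) :
  pseudovariety_of_groups H -> arborescent H ->
  pro (overline H) F -> lifts (overline H) F ->
  finite_set S -> subsemigroup S -> band S.
Proof.
move=> pvH arbH proF liftF finS SM x Sx.
have [n xx] := idempotent_power finS SM Sx.
have [D [f fcone]] := (proP _ _).1 proF.
have fX i k : f i (x ^+ k) = f i x ^+ k.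
  have [f1 fM] := cone_morphism fcone i.
  by elim: k => [//|k IHk]; rewrite !expgS fM IHk.
have ex : x ^+ n.+1 * x = x.
  apply: (cone_separated fcone) => i.
  have [HM _] := ps_objP i.
  rewrite (cone_morphism fcone i).2 fX.
  pose I := [set z | exists a b, z = a * f i (x ^+ n.+1) * b].
  have [[a [b zab]]|nI] := pselect (I (f i x)).
    apply: (power_factor_stable HM); last by rewrite -fX; exact: zab.
    by rewrite -fX -(cone_morphism fcone i).2 xx.
  have [||N [q [HN qM qS Nx]]] := counting_expansion (I := I) n.+1 pvH arbH (ps_objP i).
  - by move=> c _ [a [b ->]]; exists (c * a), b; rewrite !mulgA.
  - by move=> _ c [a [b ->]]; exists a, (b * c); rewrite !mulgA.
  have [g [gM _ gE]] := liftF _ _ q (f i) (ps_objP i) HN qM qS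
    (cone_morphism fcone i) (cone_continuous fcone).
  have gX k : g (x ^+ k) = (g x : N) ^+ k.
    by elim: k => [|k IHk]; rewrite ?gM.1// !expgS gM.2 IHk.
  case: (Nx (g x)); rewrite -?gX ?gE//.
    by exists 1, 1; rewrite mul1g mulg1.
  by rewrite -[LHS]gM.2 xx.
pose C := [set y | exists k, y = x ^+ k.+1].
have CS : C `<=` S.
  move=> _ [k ->]; elim: k => [|k IHk]; first by rewrite expg1.
  by rewrite expgS; exact: SM.
have xn k : x ^+ (n.+1 * k.+1) = x ^+ n.+1.
  by elim: k => [|k IHk]; rewrite ?muln1// mulnS expgnDr IHk.
have exk k : x ^+ n.+1 * x ^+ k.+1 = x ^+ k.+1 by rewrite (expgS x k) mulgA ex.
have xke k : x ^+ k.+1 * x ^+ n.+1 = x ^+ k.+1.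
  by rewrite -expgnDr addnC expgnDr exk.
have gC : subgroup C.
  split=> [_ _ [i ->] [j ->]|].
    by exists (i + j.+1); rewrite -expgnDr addSn.
  exists (x ^+ n.+1); first by exists n.
  split=> _ [k ->]; first by rewrite exk xke.
  (* The exponent [k.+1 * n] gives an inverse; [n.+1] keeps it positive. *)
  exists (x ^+ (k.+1 * n + n.+1)); first by exists (k.+1 * n + n); rewrite addnS.
  have xkn : x ^+ (k.+1 + (k.+1 * n + n.+1)) = x ^+ n.+1.
    by rewrite addnA -mulnS expgnDr mulnC xn xx.
  by rewrite -!expgnDr [X in _ /\ x ^+ X = _]addnC xkn.
apply: (projective_cyclic_trivial (gS := gC)).
- exact: sub_finite_set CS finS.
- by move=> T TC; apply: (finite_closed proF); apply: sub_finite_set finS => y /TC /CS.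
- exact: (subgroup_projective pvH arbH proF liftF).
- by exists 0%N; rewrite expg1.
- by [].
Qed.

Theorem corollary3 (H : finGroupType -> Prop)
    (pvH : pseudovariety_of_groups H) (arbH : arborescent H)
    (X : topologicalType) (F : preTopologicalMonoidType) (iota : X -> F)
    (freeF : free_pro (overline H) iota) :
  (forall (S : set F) (gS : subgroup S), closed S ->
     profinite_group (subgroup_type gS) /\ projective_group (subgroup_type gS)) /\
  (forall S : set F, finite_set S -> subsemigroup S -> band S).
Proof.
have proF : pro (overline H) F by have [] := freeF.
have liftF := free_pro_lifts freeF.
split=> [S gS clS|S]; last exact: finite_subsemigroup_band pvH arbH proF liftF.
split; last exact: (subgroup_projective pvH arbH proF liftF).
have [D [f fcone]] := (proP _ _).1 proF.
by apply: (closed_subgroup_profinite fcone) => // M [].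
Qed.
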